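(* Let $\Omega$ be an atomless Borel probability space with measure $\nu$, let $W:\Omega^2\to[0,1]$ be a graphon, and let $\mathfrak m$ be a matching in $W$. Then for every $\varepsilon>0$ there is $\delta>0$ such that whenever $U:\Omega^2\to[0,1]$ is a graphon with $\|U-W\|_\square<\delta$, there is a matching $\mathfrak m_U$ in $U$ such that $\|\mathfrak m_U-\mathfrak m\|_\square<\varepsilon$.
   Context: A graphon is a symmetric measurable function $W:\Omega^2\to[0,1]$. For a function $f$, $\operatorname{supp} f=\{f\neq 0\}$. A matching in a graphon $W$ is a function $\mathfrak m\in L^1(\Omega^2)$ (not necessarily symmetric) such that (M1) $\mathfrak m\ge 0$ almost everywhere; (M2) $\operatorname{supp}\mathfrak m\subseteq\operatorname{supp}W$ up to a null set; (M3) for almost every $x\in\Omega$, $\int_\Omega\mathfrak m(x,y)\,d\nu(y)+\int_\Omega\mathfrak m(y,x)\,d\nu(y)\le 1$. The cut-norm of $U\in L^1(\Omega^2)$ is $\|U\|_\square=\sup_{S,T}\left|\int_{S\times T}U\,d\nu^{\otimes 2}\right|$, where the supremum is over all measurable $S,T\subseteq\Omega$. *)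

(* Defs.v *)
From HB Require Import structures.
From mathcomp Require Import all_boot all_order all_algebra.
From mathcomp Require Import all_classical all_reals all_analysis.

Set Implicit Arguments.
Unset Strict Implicit.
Unset Printing Implicit Defensive.

Import Order.TTheory GRing.Theory Num.Theory.
Import numFieldNormedType.Exports.

Local Open Scope classical_set_scope.
Local Open Scope ring_scope.

(* T is Borel isomorphic to a complete separable metric space equipped with
   its Borel sigma-algebra; since f is a bijection, every subset of T is of the
   form f @^-1` A. *)
Definition standard_borel (R : realType) (d : measure_display)
    (T : measurableType d) : Prop :=
  exists (X : metricType R) (f : T -> X),
    [/\ forall F : set_system X, ProperFilter F -> cauchy F ->
          exists x : X, F --> x,
        exists2 D : set X, countable D & dense D,
        bijective f
      & forall A : set X, <<s @open X >> A <-> measurable (f @^-1` A)].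

Definition atomless (R : realType) (d : measure_display) (T : measurableType d)
    (P : probability T R) : Prop :=
  forall A : set T, measurable A -> (0 < P A)%E ->
    exists B : set T, [/\ measurable B, B `<=` A & (0 < P B < P A)%E].

Definition graphon (R : realType) (d : measure_display) (T : measurableType d)
    (W : T * T -> R) : Prop :=
  [/\ measurable_fun setT W,
      forall x y : T, W (x, y) = W (y, x)
    & forall z : T * T, 0 <= W z <= 1].

Definition supp (R : realType) (S : Type) (f : S -> R) : set S :=
  [set z | f z != 0].

(* For almost every x the two sections of m are nonnegative almost everywhere
   and integrable, so the integrals below are then ordinary Lebesgue
   integrals. *)
Definition matching (R : realType) (d : measure_display) (T : measurableType d)
    (P : probability T R) (W m : T * T -> R) : Prop :=
  [/\ (P \x P)%E.-integrable setT (EFin \o m),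
      {ae (P \x P)%E, forall z, 0 <= m z},
      (P \x P)%E.-negligible (supp m `\` supp W)
    & {ae P, forall x,
        (\int[P]_y (m (x, y))%:E + \int[P]_y (m (y, x))%:E <= 1)%E}].

Definition cut_norm (R : realType) (d : measure_display) (T : measurableType d)
    (P : probability T R) (U : T * T -> R) : \bar R :=
  ereal_sup [set r : \bar R | exists A B : set T,
    [/\ measurable A, measurable B
      & r = `| \int[(P \x P)%E]_(z in A `*` B) (U z)%:E |%E]].

(* Main.v *)
(* Write m = f W with f = m / W.  Simple functions s <= f with s W close to m in
   L^1 are approximated in L^1 by nonnegative combinations phi of indicators of
   sets in the algebra generated by measurable rectangles.  Multiplication by
   such a phi is bounded for the cut norm, so h = phi U is cut-close to phi W,
   hence to m, and it is supported in supp U.  Its degrees may exceed 1; dividing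
   h(x,y) by max(1, deg x) max(1, deg y) repairs this, and the mass lost is
   controlled by the cut norm of h - m because the degrees of m are at most 1. *)
Require Import Defs.
From HB Require Import structures.
From mathcomp Require Import all_boot all_order all_algebra.
From mathcomp Require Import all_classical all_reals all_analysis.
From mathcomp Require Import finmap measurable_realfun ring lra.

Set Implicit Arguments.
Unset Strict Implicit.
Unset Printing Implicit Defensive.

Import Order.TTheory GRing.Theory Num.Theory.
Import numFieldNormedType.Exports HBNNSimple.

Local Open Scope classical_set_scope.
Local Open Scope ring_scope.

(** * Bounded measurable functions and integrability *)

Definition bounded_measurable (R : realType) (d : measure_display)
    (T : measurableType d) (f : T -> R) : Prop :=
  measurable_fun setT f /\ exists K : R, forall z, `|f z| <= K.

Section integrability.
Context (R : realType) (d : measure_display) (T : measurableType d)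
  (mu : probability T R).
Local Notation int f := (mu.-integrable setT (EFin \o f)).

Lemma bounded_measurable_integrableM (f g : T -> R) :
  bounded_measurable f -> int g -> int (f \* g).
Proof.
move=> [mf [K fK]] ig.
have := @integrableMr _ _ _ mu setT measurableT f (EFin \o g) mf _ ig.
apply; exists K; split; first exact: num_real.
by move=> x Kx z _; exact: le_trans (fK z) (ltW Kx).
Qed.

Lemma bounded_measurable_integrable (f : T -> R) :
  bounded_measurable f -> int f.
Proof.
move=> [mf [K fK]]; apply: measurable_bounded_integrable => //.
  by apply: le_lt_trans (probability_le1 mu measurableT) _; rewrite ltry.
exists K; split; first exact: num_real.
by move=> x Kx z _; exact: le_trans (fK z) (ltW Kx).
Qed.

Lemma bounded_measurable_cst (c : R) :
  bounded_measurable (cst c : T -> R).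
Proof. by split=> //; exists `|c|. Qed.

Lemma bounded_measurableD (f g : T -> R) :
  bounded_measurable f -> bounded_measurable g -> bounded_measurable (f \+ g).
Proof.
move=> [mf [K fK]] [mg [L gL]]; split; first exact: measurable_funD.
exists (K + L) => z /=; exact: le_trans (ler_normD _ _) (lerD (fK z) (gL z)).
Qed.

Lemma bounded_measurableB (f g : T -> R) :
  bounded_measurable f -> bounded_measurable g -> bounded_measurable (f \- g).
Proof.
move=> [mf [K fK]] [mg [L gL]]; split; first exact: measurable_funB.
exists (K + L) => z /=; exact: le_trans (ler_normB _ _) (lerD (fK z) (gL z)).
Qed.

Lemma bounded_measurableM (f g : T -> R) :
  bounded_measurable f -> bounded_measurable g -> bounded_measurable (f \* g).
Proof.
move=> [mf [K fK]] [mg [L gL]]; split; first exact: measurable_funM.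
by exists (K * L) => z /=; rewrite normrM ler_pM.
Qed.

Lemma bounded_measurable_indic (E : set T) :
  measurable E -> bounded_measurable (\1_E : T -> R).
Proof.
by move=> mE; split=> //; exists 1 => z; rewrite indicE; case: (_ \in _);
  rewrite ?normr1 ?normr0.
Qed.

Lemma integrable_funD (f g : T -> R) : int f -> int g -> int (f \+ g).
Proof. by move=> hf hg; apply: (integrableD _ hf hg). Qed.

Lemma integrable_funB (f g : T -> R) : int f -> int g -> int (f \- g).
Proof. by move=> hf hg; apply: (integrableB _ hf hg). Qed.

Lemma integrable_normr (f : T -> R) : int f -> int (fun z => `|f z|).
Proof. by move=> hf; exact: integrable_norm. Qed.

Lemma normr_Rintegral_le (f g : T -> R) : int f -> int g ->
  (forall z, `|f z| <= g z) -> `|\int[mu]_z f z| <= \int[mu]_z g z.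
Proof.
move=> hf hg fg; apply: le_trans (le_normr_Rintegral _ _) _ => //.
by apply: le_Rintegral => //; exact: integrable_normr.
Qed.

End integrability.

(** * The cut norm and the kernels that act boundedly on it by multiplication *)

Section cut_multipliers.
Context (R : realType) (d : measure_display) (T : measurableType d)
  (P : probability T R).
Local Notation mu := (P \x P)%E.
Local Notation int f := (mu.-integrable setT (EFin \o f)).

Definition rect (A B : set T) : T * T -> R := fun z => \1_A z.1 * \1_B z.2.

(** An upper bound on the cut norm, tested by real integrals over the whole square against rectangle
    indicators, so that linearity and products of indicators apply directly. It is meant for
    integrable [D], where these integrals carry no default value. *)
Definition cut_le (D : T * T -> R) (r : R) : Prop :=
  forall A B : set T, measurable A -> measurable B ->
    `|\int[mu]_z (rect A B z * D z)| <= r.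

Lemma rectE (A B : set T) : rect A B = \1_(A `*` B) :> (T * T -> R).
Proof.
apply/funext => -[x y]; rewrite /rect /= !indicE /= -natrM mulnb; congr (_%:R).
by congr nat_of_bool; rewrite in_setX.
Qed.

Lemma bounded_measurable_rect (A B : set T) :
  measurable A -> measurable B -> bounded_measurable (rect A B).
Proof.
move=> mA mB; rewrite rectE; apply: bounded_measurable_indic.
exact: measurableX.
Qed.

Lemma cut_le_norm (D : T * T -> R) (r : R) : int D ->
  (cut_norm P D <= r%:E)%E <-> cut_le D r.
Proof.
move=> iD.
have E A B : measurable A -> measurable B ->
    `| \int[mu]_(z in A `*` B) (D z)%:E |%E
    = `|\int[mu]_z (rect A B z * D z)|%:E.
  move=> mA mB; have mAB : measurable (A `*` B) by exact: measurableX.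
  have iAB : (mu.-integrable (A `*` B) (EFin \o D)) by exact: integrableS iD.
  rewrite -EFin_normr_Rintegral // Rintegral_mkcond.
  congr (`|_|%:E); apply: eq_Rintegral => z _ /=.
  by rewrite rectE patchE indicE; case: ifPn; rewrite ?mul1r ?mul0r.
split=> [h A B mA mB|h].
  rewrite -lee_fin -E //; apply: le_trans h; apply: ereal_sup_ubound.
  by exists A, B.
apply: ge_ereal_sup => _ [A [B [mA mB ->]]].
by rewrite E // lee_fin; exact: h.
Qed.

Lemma cut_leD (D E : T * T -> R) (r s : R) : int D -> int E ->
  cut_le D r -> cut_le E s -> cut_le (D \+ E) (r + s).
Proof.
move=> iD iE hD hE A B mA mB.
under eq_Rintegral do rewrite mulrDr.
rewrite RintegralD //;
  [|exact: (bounded_measurable_integrableM (bounded_measurable_rect mA mB))..].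
by apply: le_trans (ler_normD _ _) (lerD _ _); [exact: hD|exact: hE].
Qed.

Lemma cut_leZ (c : R) (D : T * T -> R) (r : R) : int D ->
  cut_le D r -> cut_le (fun z => c * D z) (`|c| * r).
Proof.
move=> iD hD A B mA mB.
under eq_Rintegral do rewrite mulrCA.
rewrite RintegralZl //;
  last exact: (bounded_measurable_integrableM (bounded_measurable_rect mA mB)).
by rewrite normrM ler_wpM2l // hD.
Qed.

Lemma cut_le_L1 (D : T * T -> R) (r : R) : int D ->
  \int[mu]_z `|D z| <= r -> cut_le D r.
Proof.
move=> iD hD A B mA mB; apply: le_trans hD; apply: normr_Rintegral_le => //.
- exact: (bounded_measurable_integrableM (bounded_measurable_rect mA mB)).
- exact: integrable_normr.
- move=> z; rewrite rectE normrM indicE; case: (_ \in _).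
    by rewrite normr1 mul1r.
  by rewrite normr0 mul0r.
Qed.

(* Multipliers serve as step functions: they include the indicators of
   rectangles and are closed under sums and products, so no explicit partition
   is needed. *)
Definition cut_multiplier (phi : T * T -> R) : Prop :=
  bounded_measurable phi /\ exists2 C : R, 0 <= C &
    forall D r, int D -> cut_le D r -> cut_le (phi \* D) (C * r).

(** The product of a test rectangle with [rect A B] is the indicator of another rectangle, so the
    bound persists with constant 1. *)
Lemma cut_multiplier_rect (A B : set T) : measurable A -> measurable B ->
  cut_multiplier (rect A B).
Proof.
move=> mA mB; split; first exact: bounded_measurable_rect.
exists 1 => // D r iD hD A' B' mA' mB'; rewrite mul1r.
have := hD (A' `&` A) (B' `&` B) (measurableI _ _ mA' mA) (measurableI _ _ mB' mB).
congr (`| _ | <= _); apply: eq_Rintegral => z _ /=.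
by rewrite /rect !indicI /=; ring.
Qed.

Lemma cut_multiplierD (f g : T * T -> R) :
  cut_multiplier f -> cut_multiplier g -> cut_multiplier (f \+ g).
Proof.
move=> [bf [C C0 hf]] [bg [C' C'0 hg]]; split; first exact: bounded_measurableD.
exists (C + C') => [|D r iD hD]; first exact: addr_ge0.
have -> : (f \+ g) \* D = (f \* D) \+ (g \* D).
  by apply/funext => z /=; rewrite mulrDl.
rewrite mulrDl.
by apply: cut_leD; [exact: bounded_measurable_integrableM|
  exact: bounded_measurable_integrableM|exact: hf|exact: hg].
Qed.

Lemma cut_multiplierZ (c : R) (f : T * T -> R) :
  cut_multiplier f -> cut_multiplier (fun z => c * f z).
Proof.
move=> [bf [C C0 hf]]; split.
  exact: (bounded_measurableM (bounded_measurable_cst _ c) bf).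
exists (`|c| * C) => [|D r iD hD]; first exact: mulr_ge0.
have -> : (fun z => c * f z) \* D = (fun z => c * (f \* D) z).
  by apply/funext => z /=; rewrite mulrA.
rewrite -mulrA; apply: cut_leZ;
  [exact: bounded_measurable_integrableM|exact: hf].
Qed.

Lemma cut_multiplierM (f g : T * T -> R) :
  cut_multiplier f -> cut_multiplier g -> cut_multiplier (f \* g).
Proof.
move=> [bf [C C0 hf]] [bg [C' C'0 hg]]; split; first exact: bounded_measurableM.
exists (C * C') => [|D r iD hD]; first exact: mulr_ge0.
have -> : (f \* g) \* D = f \* (g \* D).
  by apply/funext => z /=; rewrite mulrA.
rewrite -mulrA; apply: hf;
  [exact: bounded_measurable_integrableM|exact: hg].
Qed.

(** * Approximation of measurable sets and simple functions in L^1 *)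

Lemma indic_setC (E : set (T * T)) :
  \1_(~` E) = (fun z => 1 + (-1) * \1_E z) :> (T * T -> R).
Proof.
by apply/funext => z; rewrite !indicE in_setC; case: (z \in E) => /=; lra.
Qed.

Definition multiplier_set (E : set (T * T)) : Prop :=
  measurable E /\ cut_multiplier \1_E.

Lemma multiplier_setX (A B : set T) : measurable A -> measurable B ->
  multiplier_set (A `*` B).
Proof.
move=> mA mB; split; first exact: measurableX.
by rewrite -rectE; exact: cut_multiplier_rect.
Qed.

(** The indicator of the difference is [\1_E] times [1 - \1_F], and the constant 1 is a multiplier
    because it is the indicator of the full rectangle. *)
Lemma multiplier_setD (E F : set (T * T)) :
  multiplier_set E -> multiplier_set F -> multiplier_set (E `\` F).
Proof.
move=> [mE hE] [mF hF]; split; first exact: measurableD.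
rewrite setDE indicI; apply: cut_multiplierM => //.
rewrite indic_setC; apply: (@cut_multiplierD (cst 1)); last exact: cut_multiplierZ.
have := cut_multiplier_rect (@measurableT _ T) (@measurableT _ T).
by rewrite rectE setXTT indicT.
Qed.

Lemma integrable_indic_dist (E F : set (T * T)) : measurable E -> measurable F ->
  int (fun z => `|\1_E z - \1_F z| : R).
Proof.
move=> mE mF; apply: integrable_normr.
by apply: integrable_funB; apply: bounded_measurable_integrable;
  exact: bounded_measurable_indic.
Qed.

(** A Dynkin argument: the approximable sets contain the measurable rectangles, which form a
    generating pi-system, and are closed under proper differences and increasing unions. The
    multiplier constant of [F] may blow up as [eps] tends to 0; this is harmless, since [eps] is
    fixed before it is used. *)
Lemma multiplier_set_approx (E : set (T * T)) : measurable E ->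
  forall eps : R, 0 < eps -> exists2 F : set (T * T), multiplier_set F &
    \int[mu]_z `|\1_E z - \1_F z| <= eps.
Proof.
pose H := [set E : set (T * T) | measurable E /\
  forall eps : R, 0 < eps -> exists2 F : set (T * T), multiplier_set F &
    \int[mu]_z `|\1_E z - \1_F z| <= eps].
suff : @measurable _ (T * T)%type `<=` H by move=> h mE; case: (h _ mE).
have HX A B : measurable A -> measurable B -> H (A `*` B).
  move=> mA mB; split=> [|eps eps0]; first exact: measurableX.
  exists (A `*` B); first exact: multiplier_setX.
  under eq_Rintegral do rewrite subrr normr0.
  by rewrite Rintegral_cst // mul0r ltW.
rewrite measurable_prod_measurableType.
apply: lambda_system_subset => //.
- move=> _ _ [X1 mX1 [X2 mX2 <-]] [Y1 mY1 [Y2 mY2 <-]].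
  exists (X1 `&` Y1); first exact: measurableI.
  by exists (X2 `&` Y2); [exact: measurableI|rewrite setXI].
- split=> //.
  + by rewrite -setXTT; exact: HX.
  + move=> {}E F FE [mE hE] [mF hF]; split=> [|eps eps0]; first exact: measurableD.
    have eps20 : 0 < eps / 2 by rewrite divr_gt0.
    have [E' gE hE'] := hE _ eps20; have [F' gF hF'] := hF _ eps20.
    have [mE' _] := gE; have [mF' _] := gF.
    exists (E' `\` F'); first exact: multiplier_setD.
    apply: (@le_trans _ _ (\int[mu]_z (`|\1_E z - \1_E' z| + `|\1_F z - \1_F' z|))).
      apply: le_Rintegral => //.
      * by apply: integrable_indic_dist; exact: measurableD.
      * by apply: integrable_funD; exact: integrable_indic_dist.
      (* Pointwise, the indicators of [E \ F] and [E' \ F'] differ only where [E], [E'] or [F], [F']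
         differ; this is checked over all sixteen membership patterns. *)
      * move=> z _; rewrite !setDE !indicI !indic_setC /= !indicE.
        by do 4 case: (_ \in _); rewrite ?(mulN1r, oppr0, addr0, subrr, mul0r, mul1r,
          mulr0, sub0r, subr0, normrN, normr0, normr1, add0r); lra.
    rewrite RintegralD //; [|exact: integrable_indic_dist..].
    by rewrite (splitr eps) lerD.
  + move=> F ndF hF; have mF n : measurable (F n) by case: (hF n).
    have mU : measurable (\bigcup_n F n) by exact: bigcupT_measurable.
    split=> // eps eps0; have eps20 : 0 < eps / 2 by rewrite divr_gt0.
    (* Continuity from below gives an [n] with [F n] within [eps / 2] of the union in measure; an
       approximation of [F n] within [eps / 2] then serves for the union. *)
    have /fine_cvgP[_] : mu \o F @ \oo --> (fine (mu (\bigcup_n F n)))%:E.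
      rewrite fineK; first exact: (@nondecreasing_cvg_mu _ _ _ mu F mF mU ndF).
      rewrite ge0_fin_numE //.
      by apply: le_lt_trans (probability_le1 mu mU) _; rewrite ltry.
    move=> /cvgrPdist_le /(_ _ eps20)[n _ /(_ n (leqnn n)) /= hn].
    have [_ /(_ _ eps20)[E' gE' hE']] := hF n.
    have [mE' _] := gE'; exists E' => //.
    apply: (@le_trans _ _ (\int[mu]_z (`|\1_(\bigcup_n F n) z - \1_(F n) z| +
        `|\1_(F n) z - \1_E' z|))).
      apply: le_Rintegral => //.
      * exact: integrable_indic_dist.
      * by apply: integrable_funD; exact: integrable_indic_dist.
      * by move=> z _; exact: ler_distD.
    rewrite RintegralD //; [|exact: integrable_indic_dist..].
    rewrite (splitr eps) lerD //; apply: le_trans hn.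
    under eq_Rintegral.
      move=> z _; have -> : `|\1_(\bigcup_n F n) z - \1_(F n) z| =
        \1_(\bigcup_n F n) z - \1_(F n) z :> R.
        apply: ger0_norm; rewrite subr_ge0 !indicE ler_nat.
        case: (boolP (z \in F n)) => // /set_mem Fz.
        by rewrite mem_set //; exists n.
      over.
    rewrite RintegralB //; [|by apply: bounded_measurable_integrable;
      exact: bounded_measurable_indic..].
    by rewrite /Rintegral !integral_indic // !setIT ler_norm.
- by move=> _ [A mA [B mB <-]]; exact: HX.
Qed.

(** The approximants are required to be nonnegative because the product of one of them with [U] has
    to become a matching. *)
Definition approx_by_multipliers (f : T * T -> R) : Prop :=
  int f /\ forall eps : R, 0 < eps -> exists phi : T * T -> R,
    [/\ cut_multiplier phi, forall z, 0 <= phi z &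
        \int[mu]_z `|f z - phi z| <= eps].

Lemma approx_by_multipliers0 : approx_by_multipliers (cst 0).
Proof.
split=> [|eps eps0].
  by apply: bounded_measurable_integrable; exact: bounded_measurable_cst.
exists (cst 0); split=> //.
  (* The zero function is the indicator of the empty rectangle. *)
  have := cut_multiplier_rect (@measurable0 _ T) (@measurable0 _ T).
  by rewrite rectE setX0 indic0.
under eq_Rintegral do rewrite subrr normr0.
by rewrite Rintegral_cst // mul0r ltW.
Qed.

Lemma cut_multiplier_integrable (f : T * T -> R) : cut_multiplier f -> int f.
Proof. by move=> [/bounded_measurable_integrable]. Qed.

Lemma approx_by_multipliersD (f g : T * T -> R) :
  approx_by_multipliers f -> approx_by_multipliers g ->
  approx_by_multipliers (f \+ g).
Proof.
move=> [iff hf] [ig hg]; split=> [|eps eps0]; first exact: integrable_funD.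
have eps20 : 0 < eps / 2 by rewrite divr_gt0.
have [p [mp p0 hp]] := hf _ eps20; have [q [mq q0 hq]] := hg _ eps20.
have ip := cut_multiplier_integrable mp; have iq := cut_multiplier_integrable mq.
exists (p \+ q); split=> [|z|].
- exact: cut_multiplierD.
- exact: addr_ge0.
have ifp : int (fun z => `|f z - p z|).
  by apply: integrable_normr; exact: integrable_funB.
have igq : int (fun z => `|g z - q z|).
  by apply: integrable_normr; exact: integrable_funB.
rewrite (splitr eps); apply: le_trans (lerD hp hq).
rewrite -RintegralD //; apply: le_Rintegral => //.
- by apply: integrable_normr; apply: integrable_funB; exact: integrable_funD.
- exact: integrable_funD.
- by move=> z _ /=; rewrite opprD addrACA ler_normD.
Qed.

Lemma approx_by_multipliers_indic (c : R) (E : set (T * T)) : 0 <= c ->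
  measurable E -> approx_by_multipliers (fun z => c * \1_E z).
Proof.
move=> c0 mE.
have iZ (F : set (T * T)) : measurable F -> int (fun z => c * \1_F z).
  move=> mF; apply: bounded_measurable_integrable.
  apply: (bounded_measurableM (bounded_measurable_cst _ c)).
  exact: bounded_measurable_indic.
split=> [|eps eps0]; first exact: iZ.
(* Dividing by [c + 1] instead of [c] also covers [c = 0]. *)
have c10 : 0 < c + 1 by rewrite ltr_wpDl.
have [F gF hF] := multiplier_set_approx mE (divr_gt0 eps0 c10).
have [mF mulF] := gF; exists (fun z => c * \1_F z); split.
- exact: cut_multiplierZ.
- by move=> z; rewrite mulr_ge0.
under eq_Rintegral do rewrite -mulrBr normrM (ger0_norm c0).
rewrite RintegralZl //; last exact: integrable_indic_dist.
have := ler_wpM2l c0 hF; move=> /le_trans; apply.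
by rewrite mulrA ler_pdivrMr // mulrC ler_wpM2l ?ltW // ltrDl.
Qed.

(** A nonnegative simple function is a finite combination, with nonnegative coefficients, of the
    indicators of its level sets; induction runs over the list of its values. *)
Lemma approx_by_multipliers_nnsfun (s : {nnsfun (T * T)%type >-> R}) :
  approx_by_multipliers s.
Proof.
have -> : s = (fun z => \sum_(y <- fset_set (range s))
    y * \1_(s @^-1` [set y]) z)  :> (T * T -> R).
  by apply/funext => z; rewrite fimfunE fsbig_finite.
have : {in fset_set (range s) : seq R, forall y, 0 <= y}.
  by move=> y; rewrite in_fset_set // => /set_mem[z _ <-].
elim: (fset_set (range s) : seq R) => [_|y l IHl hl].
  under eq_fun do rewrite big_nil; exact: approx_by_multipliers0.
under eq_fun do rewrite big_cons; apply: approx_by_multipliersD.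
  apply: approx_by_multipliers_indic; first by apply: hl; rewrite mem_head.
  exact: measurable_sfunP.
by apply: IHl => x xl; apply: hl; rewrite inE xl orbT.
Qed.

End cut_multipliers.

(** * Approximation of a matching in [W] by products [phi W] *)

Section matching_approximation.
Context (R : realType) (d : measure_display) (T : measurableType d)
  (P : probability T R).
Local Notation mu := (P \x P)%E.
Local Notation int f := (mu.-integrable setT (EFin \o f)).

Lemma graphon_bounded_measurable (W : T * T -> R) :
  graphon W -> bounded_measurable W.
Proof.
move=> [mW _ W01]; split=> //; exists 1 => z.
by have /andP[W0 W1] := W01 z; rewrite ger0_norm.
Qed.

(* [m / W] may fail to be integrable, but [s * W] increases to [m] when [s]
   increases to [m / W]. *)
Lemma matching_nnsfun_approx (W m : T * T -> R) :
  graphon W -> matching P W m -> forall eps : R, 0 < eps ->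
  exists s : {nnsfun (T * T)%type >-> R}, \int[mu]_z `|s z * W z - m z| <= eps.
Proof.
move=> hW [im m0 mW _] eps eps0.
have [measW _ W01] := hW.
have measm : measurable_fun setT m.
  by apply/measurable_EFinP; exact: (measurable_int _ im).
(* The quotient [m / W], made nonnegative everywhere since [m] is so only almost everywhere. The
   inverse is a real power, so measurability follows by composition; its value where [W] vanishes is
   immaterial because [f] is only used multiplied by [W]. *)
pose f z := (Num.max (m z) 0 * W z `^ (-1))%:E.
have mf : measurable_fun setT f.
  apply/measurable_EFinP; apply: measurable_funM.
    by apply: measurable_maxr => //.
  by apply: (@measurableT_comp _ _ _ _ _ _ (fun x : R => x `^ (-1))).
have f0 z : (0 <= f z)%E.
  by rewrite lee_fin mulr_ge0 ?powR_ge0 // le_max lexx orbT.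
pose s := nnsfun_approx measurableT mf.
have mW0 : {ae mu, forall z, W z = 0 -> m z = 0}.
  apply: negligibleS mW => z /= /not_implyP[Wz mz]; split.
    by apply/eqP.
  by rewrite /supp /= Wz eqxx.
have fW z : 0 <= m z -> (W z = 0 -> m z = 0) -> (f z * (W z)%:E = (m z)%:E)%E.
  move=> mz0 mz; have /andP[Wz0 _] := W01 z.
  rewrite /f -EFinM max_l // powR_inv1 //.
  have [Wz|Wz] := eqVneq (W z) 0; first by rewrite Wz mulr0 mz.
  by rewrite divfK.
have good : {ae mu, forall z, 0 <= m z /\ (W z = 0 -> m z = 0)}.
  by move: m0 mW0; apply: filterS2 => z ? ?; split.
(* Almost everywhere [s n * W] tends to [f * W = m] and is dominated by [|m|], since [s n <= f];
   dominated convergence then yields convergence in L^1. *)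
have [||||_ + _] := @dominated_convergence _ _ _ mu setT measurableT
  (fun n z => (s n z * W z)%:E) (EFin \o m) (fun z => `|m z|%:E) _
  (measurable_int _ im).
- by move=> n; apply/measurable_EFinP; exact: measurable_funM.
- apply: filterS good => z [mz0 mz] _ /=; rewrite -fW //.
  under eq_fun do rewrite EFinM.
  by apply: cvgeZr => //; exact: cvg_nnsfun_approx.
- exact: integrable_normr.
- apply: filterS good => z [mz0 mz] n _ /=.
  have /andP[Wz0 _] := W01 z.
  rewrite lee_fin !ger0_norm ?mulr_ge0 // -lee_fin -fW // EFinM.
  apply: lee_wpmul2r => //; rewrite /s nnsfun_approxE.
  by apply: le_approx.
move=> /fine_cvgP[_ /cvgrPdist_le /(_ _ eps0)[n _ /(_ n (leqnn n)) /=]].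
rewrite sub0r normrN => hn; exists (s n); exact: le_trans (ler_norm _) hn.
Qed.

(** Since [0 <= W <= 1], multiplication by [W] does not increase the L^1 distance between [s] and
    [phi]; the two halves of [eps] pay for [s W] against [m] and for [phi] against [s]. *)
Lemma matching_multiplier_approx (W m : T * T -> R) :
  graphon W -> matching P W m -> forall eps : R, 0 < eps ->
  exists phi : T * T -> R, [/\ cut_multiplier P phi, forall z, 0 <= phi z &
    \int[mu]_z `|phi z * W z - m z| <= eps].
Proof.
move=> hW hm eps eps0; have eps20 : 0 < eps / 2 by rewrite divr_gt0.
have [s hs] := matching_nnsfun_approx hW hm eps20.
have [is' /(_ _ eps20)[phi [mphi phi0 hphi]]] := approx_by_multipliers_nnsfun P s.
have bW := graphon_bounded_measurable hW; have [im _ _ _] := hm.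
have [_ _ W01] := hW; have iphi := cut_multiplier_integrable mphi.
have iW (f : T * T -> R) : int f -> int (fun z => f z * W z).
  move=> iff; have := bounded_measurable_integrableM bW iff.
  by congr (integrable _ _ _); apply/funext => z /=; rewrite mulrC.
exists phi; split=> //; rewrite (splitr eps); apply: le_trans (lerD hphi hs).
have i1 : int (fun z => `|s z - phi z|).
  by apply: integrable_normr; exact: integrable_funB.
have i2 : int (fun z => `|s z * W z - m z|).
  by apply: integrable_normr; apply: integrable_funB => //; exact: iW.
rewrite -RintegralD //; apply: le_Rintegral => //.
- by apply: integrable_normr; apply: integrable_funB => //; exact: iW.
- exact: integrable_funD.
- move=> z _; apply: le_trans (ler_distD (s z * W z) _ _) _; rewrite lerD2r.
  have /andP[W0 W1] := W01 z.
  by rewrite -mulrBl normrM distrC (ger0_norm W0) ler_piMr.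
Qed.

End matching_approximation.

(** * Degrees via Fubini, and the rescaling that caps them at 1 *)

Section degree_capping.
Context (R : realType) (d : measure_display) (T : measurableType d)
  (P : probability T R).
Local Notation mu := (P \x P)%E.
Local Notation int f := (mu.-integrable setT (EFin \o f)).

Lemma bounded_measurable_section1 (k : T * T -> R) (x : T) :
  bounded_measurable k -> bounded_measurable (fun y => k (x, y)).
Proof.
move=> [mk [K kK]]; split; last by exists K => y; exact: kK.
by apply: (measurableT_comp mk); exact: measurable_pair1.
Qed.

Lemma bounded_measurable_section2 (k : T * T -> R) (y : T) :
  bounded_measurable k -> bounded_measurable (fun x => k (x, y)).
Proof.
move=> [mk [K kK]]; split; last by exists K => x; exact: kK.
by apply: (measurableT_comp mk); exact: measurable_pair2.
Qed.

Lemma bounded_measurable_fst (a : T -> R) : bounded_measurable a ->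
  bounded_measurable (fun z : T * T => a z.1).
Proof.
move=> [ma [K aK]]; split; last by exists K => z; exact: aK.
exact: (measurableT_comp ma measurable_fst).
Qed.

Lemma bounded_measurable_snd (a : T -> R) : bounded_measurable a ->
  bounded_measurable (fun z : T * T => a z.2).
Proof.
move=> [ma [K aK]]; split; last by exists K => z; exact: aK.
exact: (measurableT_comp ma measurable_snd).
Qed.

Definition outdeg (k : T * T -> R) (x : T) : R := \int[P]_y k (x, y).
Definition indeg (k : T * T -> R) (y : T) : R := \int[P]_x k (x, y).

Lemma outdegE (k : T * T -> R) (x : T) : bounded_measurable k ->
  (\int[P]_y (k (x, y))%:E = (outdeg k x)%:E)%E.
Proof.
move=> bk; rewrite /outdeg /Rintegral fineK //; apply: integrable_fin_num => //.
by apply: bounded_measurable_integrable; exact: bounded_measurable_section1.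
Qed.

Lemma indegE (k : T * T -> R) (y : T) : bounded_measurable k ->
  (\int[P]_x (k (x, y))%:E = (indeg k y)%:E)%E.
Proof.
move=> bk; rewrite /indeg /Rintegral fineK //; apply: integrable_fin_num => //.
by apply: bounded_measurable_integrable; exact: bounded_measurable_section2.
Qed.

Lemma Rintegral_outdeg (k : T * T -> R) : bounded_measurable k ->
  \int[mu]_z k z = \int[P]_x outdeg k x.
Proof.
move=> bk; rewrite /Rintegral -integral12_prod_meas1; last first.
  exact: bounded_measurable_integrable.
by congr fine; apply: eq_integral => x _; rewrite -outdegE.
Qed.

Lemma Rintegral_indeg (k : T * T -> R) : bounded_measurable k ->
  \int[mu]_z k z = \int[P]_y indeg k y.
Proof.
move=> bk; rewrite /Rintegral -integral21_prod_meas1; last first.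
  exact: bounded_measurable_integrable.
by congr fine; apply: eq_integral => x _; rewrite -indegE.
Qed.

Lemma bounded_measurable_outdeg (k : T * T -> R) :
  bounded_measurable k -> bounded_measurable (outdeg k).
Proof.
move=> bk; split.
  apply: (@measurableT_comp _ _ _ _ _ _ fine _ (fubini_F P (EFin \o k))) => //.
  apply: measurable_fubini_F.
  exact: bounded_measurable_integrable.
have [mk [K kK]] := bk; exists K => x.
apply: (@le_trans _ _ (\int[P]_y K)).
  apply: normr_Rintegral_le => //.
  - by apply: bounded_measurable_integrable; exact: bounded_measurable_section1.
  - exact: (bounded_measurable_integrable _ (bounded_measurable_cst _ K)).
by rewrite Rintegral_cst // [fine _](congr1 fine (probability_setT P)) mulr1.
Qed.

Lemma bounded_measurable_indeg (k : T * T -> R) :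
  bounded_measurable k -> bounded_measurable (indeg k).
Proof.
move=> bk; split.
  apply: (@measurableT_comp _ _ _ _ _ _ fine _ (fubini_G P (EFin \o k))) => //.
  apply: measurable_fubini_G.
  exact: bounded_measurable_integrable.
have [mk [K kK]] := bk; exists K => x.
apply: (@le_trans _ _ (\int[P]_y K)).
  apply: normr_Rintegral_le => //.
  - by apply: bounded_measurable_integrable; exact: bounded_measurable_section2.
  - exact: (bounded_measurable_integrable _ (bounded_measurable_cst _ K)).
by rewrite Rintegral_cst // [fine _](congr1 fine (probability_setT P)) mulr1.
Qed.

Lemma Rintegral_fst (a : T -> R) (k : T * T -> R) :
  bounded_measurable a -> bounded_measurable k ->
  \int[mu]_z (a z.1 * k z) = \int[P]_x (a x * outdeg k x).
Proof.
move=> ba bk; rewrite Rintegral_outdeg; last first.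
  exact: (bounded_measurableM (bounded_measurable_fst ba) bk).
apply: eq_Rintegral => x _; rewrite /outdeg /= RintegralZl //.
by apply: bounded_measurable_integrable; exact: bounded_measurable_section1.
Qed.

Lemma Rintegral_snd (a : T -> R) (k : T * T -> R) :
  bounded_measurable a -> bounded_measurable k ->
  \int[mu]_z (a z.2 * k z) = \int[P]_y (a y * indeg k y).
Proof.
move=> ba bk; rewrite Rintegral_indeg; last first.
  exact: (bounded_measurableM (bounded_measurable_snd ba) bk).
apply: eq_Rintegral => x _; rewrite /indeg /= RintegralZl //.
by apply: bounded_measurable_integrable; exact: bounded_measurable_section2.
Qed.

(** Tonelli for [|k|], combined with the bound of the modulus of each inner integral by the integral
    of the modulus. *)
Lemma integrable_fubini_G (k : T * T -> \bar R) :
  mu.-integrable setT k -> P.-integrable setT (fubini_G P k).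
Proof.
move=> ik; have mk := measurable_int _ ik; apply/integrableP; split.
  exact: (@measurable_fubini_G _ _ _ _ _ P P _ ik).
have /integrableP[_] := ik.
rewrite (@fubini_tonelli2 _ _ _ _ _ P P (abse \o k)); last 2 first.
- exact: measurableT_comp.
- by move=> z; exact: abse_ge0.
apply: le_lt_trans; apply: ge0_le_integral => //.
- by apply: measurableT_comp => //; exact: (@measurable_fubini_G _ _ _ _ _ P P _ ik).
- apply: (@measurable_fun_fubini_tonelli_G _ _ _ _ _ P (abse \o k)).
    exact: measurableT_comp.
  by move=> z; exact: abse_ge0.
- move=> y _; apply: le_abse_integral => //.
  by apply: (measurableT_comp mk); exact: measurable_pair2.
Qed.

(** By Fubini the left side is the integral over [A] of the total degree of [m], which is at most 1
    almost everywhere. *)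
Lemma matching_degree_le (W m : T * T -> R) (A : set T) :
  matching P W m -> measurable A ->
  \int[mu]_z (rect R A setT z * m z) + \int[mu]_z (rect R setT A z * m z)
  <= \int[P]_x \1_A x.
Proof.
move=> [im _ _ dm] mA.
have i1 : int (fun z => rect R A setT z * m z).
  exact: (bounded_measurable_integrableM (bounded_measurable_rect _ mA measurableT)).
have i2 : int (fun z => rect R setT A z * m z).
  exact: (bounded_measurable_integrableM (bounded_measurable_rect _ measurableT mA)).
have i3 : P.-integrable setT (EFin \o \1_A).
  by apply: bounded_measurable_integrable; exact: bounded_measurable_indic.
rewrite /Rintegral -fineD;
  [|exact: (integrable_fin_num _ i1)|exact: (integrable_fin_num _ i2)].
rewrite -(integral12_prod_meas1 i1) -(integral21_prod_meas1 i2).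
have iF := integrable_fubini_F i1; have iG := integrable_fubini_G i2.
rewrite -integralD //; set k := (fun x => _ + _)%E.
have ik : P.-integrable setT k by exact: integrableD.
apply: fine_le; [exact: integrable_fin_num..|].
(* The almost-everywhere comparison is between nonnegative functions, and [k] need not be
   nonnegative at every point; its positive part is compared with [\1_A] instead. *)
apply: (@le_trans _ _ (\int[P]_x (k^\+ x))%E).
  apply: le_integral => //; first exact: integrable_funepos.
  by move=> x _; rewrite funeposE le_max lexx.
apply: ae_ge0_le_integral => //.
- exact: (measurable_int _ (integrable_funepos _ ik)).
- exact: (measurable_int _ i3).
apply: filterS dm => x dx _; rewrite funeposE /k /fubini_F /fubini_G /=.
rewrite ge_max lee_fin; apply/andP; split=> //.
have [xA|xA] := boolP (x \in A).
  rewrite indicE xA; apply: le_trans dx; rewrite le_eqVlt; apply/orP; left.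
  apply/eqP; congr (_ + _)%E; apply: eq_integral => y _;
    by rewrite rectE indicE in_setX /= in_setT ?andbT /= xA mul1r.
rewrite !integral0_eq ?adde0 ?lee_fin // => y _;
  by rewrite rectE indicE in_setX /= (negbTE xA) ?andbF mul0r.
Qed.

(* The rescaled kernel [mU] is [h(x,y) / (max(1, D x) max(1, D y))], where [D]
   is the total degree of [h].  On the set [A] where [D > 1] the matching [m]
   has degree at most 1, so the mass removed, at most the integral of [D - 1]
   over [A], is at most the integral of [h - m] over [A * T] and [T * A]. *)
Lemma matching_of_cut_close (U W m h : T * T -> R) (r : R) :
  matching P W m -> bounded_measurable h -> (forall z, 0 <= h z) ->
  (forall z, U z = 0 -> h z = 0) -> cut_le P (h \- m) r ->
  exists2 mU : T * T -> R, matching P U mU & cut_le P (mU \- h) (r + r).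
Proof.
move=> hm bh h0 hU hr.
pose D := outdeg h \+ indeg h.
have bD : bounded_measurable D.
  by apply: bounded_measurableD; [exact: bounded_measurable_outdeg|
    exact: bounded_measurable_indeg].
have [mD _] := bD.
have D0 x : 0 <= D x by rewrite addr_ge0 // Rintegral_ge0.
pose g x := (Num.max 1 (D x)) `^ (-1).
have max1 x : 1 <= Num.max 1 (D x) by rewrite le_max lexx.
have gE x : g x = (Num.max 1 (D x))^-1.
  by rewrite /g powR_inv1 //; exact: le_trans (max1 x).
have g0 x : 0 <= g x by exact: powR_ge0.
have g1 x : g x <= 1.
  by rewrite gE invf_le1 //; exact: lt_le_trans (max1 x).
have bg : bounded_measurable g.
  split; last by exists 1 => x; rewrite ger0_norm.
  apply: (@measurableT_comp _ _ _ _ _ _ (fun x : R => x `^ (-1))) => //.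
  exact: measurable_maxr.
have gD x : g x * D x <= 1.
  rewrite gE mulrC ler_pdivrMr; last exact: lt_le_trans (max1 x).
  by rewrite mul1r le_max lexx orbT.
pose mU z := g z.1 * g z.2 * h z.
have bgg : bounded_measurable (fun z : T * T => g z.1 * g z.2).
  exact: (bounded_measurableM (bounded_measurable_fst bg)
    (bounded_measurable_snd bg)).
have bmU : bounded_measurable mU by exact: (bounded_measurableM bgg bh).
exists mU.
  split.
  - exact: bounded_measurable_integrable.
  - by apply: aeW => z; rewrite !mulr_ge0.
  - rewrite (_ : _ `\` _ = set0); first exact: negligible_set0.
    apply/seteqP; split=> // z [/= mz] /negP; rewrite negbK => /eqP /hU hz.
    by move: mz; rewrite /supp /= /mU hz mulr0 eqxx.
  (* In both degrees the factor of [g] at the other endpoint is bounded by 1, leaving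
     [g x * D x <= 1]. *)
  - apply: aeW => x; rewrite outdegE // indegE // -EFinD lee_fin.
    apply: le_trans (gD x); rewrite mulrDr.
    have b1 k := bounded_measurable_section1 x (k : bounded_measurable _).
    have b2 k := bounded_measurable_section2 x (k : bounded_measurable _).
    apply: lerD.
      rewrite /outdeg -RintegralZl //; last first.
        by apply: bounded_measurable_integrable; exact: b1.
      apply: le_Rintegral => //.
      + by apply: bounded_measurable_integrable; exact: b1.
      + apply: bounded_measurable_integrable.
        exact: (bounded_measurableM (bounded_measurable_cst _ (g x)) (b1 _ bh)).
      + by move=> y _; rewrite /mU ler_wpM2r // ler_piMr.
    rewrite /indeg -RintegralZl //; last first.
      by apply: bounded_measurable_integrable; exact: b2.
    apply: le_Rintegral => //.
    + by apply: bounded_measurable_integrable; exact: b2.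
    + apply: bounded_measurable_integrable.
      exact: (bounded_measurableM (bounded_measurable_cst _ (g x)) (b2 _ bh)).
    + by move=> y _; rewrite /mU ler_wpM2r // ler_piMl.
have bg' : bounded_measurable (fun x => 1 - g x).
  exact: (bounded_measurableB (bounded_measurable_cst _ 1) bg).
have bgh1 : bounded_measurable (fun z => (1 - g z.1) * h z).
  exact: (bounded_measurableM (bounded_measurable_fst bg') bh).
have bgh2 : bounded_measurable (fun z => (1 - g z.2) * h z).
  exact: (bounded_measurableM (bounded_measurable_snd bg') bh).
have bmUh : bounded_measurable (mU \- h) by exact: bounded_measurableB.
apply: cut_le_L1; first exact: bounded_measurable_integrable.
(* For [a], [b] in [0,1], [1 - a b <= (1 - a) + (1 - b)], because [(1 - a)(1 - b) >= 0]. The loss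
   thus splits into one term per endpoint. *)
apply: (@le_trans _ _ (\int[mu]_z ((1 - g z.1) * h z + (1 - g z.2) * h z))).
  apply: le_Rintegral => //.
  - by apply: integrable_normr; exact: bounded_measurable_integrable.
  - by apply: bounded_measurable_integrable; exact: bounded_measurableD.
  - move=> z _ /=; rewrite /mU -[X in _ - X]mul1r -mulrBl -mulrDl normrM.
    rewrite (ger0_norm (h0 z)).
    apply: ler_wpM2r => //; rewrite ler0_norm; last by rewrite subr_le0 mulr_ile1.
    have := mulr_ge0 (_ : 0 <= 1 - g z.1) (_ : 0 <= 1 - g z.2).
    by rewrite !subr_ge0 => /(_ (g1 _) (g1 _)); lra.
rewrite RintegralD //; [|exact: bounded_measurable_integrable..].
rewrite (Rintegral_fst bg' bh) (Rintegral_snd bg' bh).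
pose A := [set x | 1 < D x].
have mA : measurable A.
  rewrite (_ : A = D @^-1` `]1, +oo[); first by rewrite -[_ @^-1` _]setTI; exact: mD.
  by apply/seteqP; split=> x /=; rewrite in_itv /= andbT.
have bA : bounded_measurable (\1_A : T -> R) by exact: bounded_measurable_indic.
have bo := bounded_measurable_outdeg bh; have bi := bounded_measurable_indeg bh.
have intP k : bounded_measurable k -> P.-integrable setT (EFin \o k).
  exact: bounded_measurable_integrable.
(* Pointwise [(1 - g) D = \1_A (D - 1)]: on [A] one has [g D = 1], and off [A] one has [g = 1]. *)
have -> : \int[P]_x ((1 - g x) * outdeg h x) + \int[P]_x ((1 - g x) * indeg h x)
    = \int[P]_x (\1_A x * outdeg h x) + \int[P]_x (\1_A x * indeg h x)
      - \int[P]_x \1_A x.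
  rewrite -!RintegralD //; try exact: intP (bounded_measurableM _ _).
  rewrite -RintegralB //; last 2 first.
  - apply: intP.
    exact: (bounded_measurableD (bounded_measurableM bA bo)
      (bounded_measurableM bA bi)).
  - exact: intP.
  apply: eq_Rintegral => x _; rewrite -!mulrDr.
  change (outdeg h x + indeg h x) with (D x).
  rewrite gE indicE; have [xA|xA] := boolP (x \in A).
    have D1 : 1 < D x by exact: (set_mem xA).
    rewrite max_r ?(ltW D1) // mul1r mulrBl mulVf ?mul1r //.
    by rewrite gt_eqF // (lt_trans _ D1).
  have D1 : D x <= 1 by rewrite leNgt; apply: contra xA => ?; exact: mem_set.
  by rewrite max_l // invr1 subrr !mul0r subr0.
rewrite -(Rintegral_fst bA bh) -(Rintegral_snd bA bh).
have [im _ _ _] := hm.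
have rectT (f : T * T -> R) z :
    (rect R A setT z * f z = \1_A z.1 * f z) *
    (rect R setT A z * f z = \1_A z.2 * f z).
  by rewrite /rect !indicT mulr1 mul1r.
have ih : int h by exact: bounded_measurable_integrable.
have split_rect B C : measurable B -> measurable C ->
    \int[mu]_z (rect R B C z * (h \- m) z) =
    \int[mu]_z (rect R B C z * h z) - \int[mu]_z (rect R B C z * m z).
  move=> mB mC; under eq_Rintegral do rewrite mulrBr.
  by rewrite RintegralB //;
    exact: (bounded_measurable_integrableM (bounded_measurable_rect _ mB mC)).
(* Replacing [h] by [m] on [A * T] and on [T * A] costs [r] each; what remains is the degree of [m]
   over [A] minus the measure of [A], which is at most 0. *)
have h1 := hr A setT mA measurableT; have h2 := hr setT A measurableT mA.
have h3 := matching_degree_le hm mA.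
rewrite split_rect // ler_norml in h1; rewrite split_rect // ler_norml in h2.
have e1 : \int[mu]_z (\1_A z.1 * h z) = \int[mu]_z (rect R A setT z * h z).
  by apply: eq_Rintegral => z _; rewrite rectT.
have e2 : \int[mu]_z (\1_A z.2 * h z) = \int[mu]_z (rect R setT A z * h z).
  by apply: eq_Rintegral => z _; rewrite rectT.
rewrite e1 e2; move: h1 h2 h3 => /andP[_ h1] /andP[_ h2] h3; lra.
Qed.

End degree_capping.

(** * Choice of [delta] and assembly of the estimates *)

Theorem theorem23 (R : realType) (d : measure_display) (T : measurableType d)
    (P : probability T R) (hT : standard_borel R T) (hP : atomless P)
    (W m : T * T -> R) (hW : graphon W) (hm : matching P W m) :
  forall eps : R, 0 < eps ->
    exists2 delta : R, 0 < delta &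
      forall U : T * T -> R, graphon U ->
        (cut_norm P (U \- W)%R < delta%:E)%E ->
        exists2 mU : T * T -> R, matching P U mU &
          (cut_norm P (mU \- m)%R < eps%:E)%E.
Proof.
(* Error budget: [h] is within [2 eta] of [m], capping costs twice that, so the total is [6 eta],
   strictly below [eps = 8 eta]. *)
move=> eps eps0; have eta0 : 0 < eps / 8 by rewrite divr_gt0.
set eta := eps / 8 in eta0.
have [phi [[bphi [C C0 hC]] phi0 hphi]] := matching_multiplier_approx hW hm eta0.
have C10 : 0 < C + 1 by rewrite ltr_wpDl.
(* The constant [C] comes from [phi], hence from [W], [m] and [eps] only; this [delta] gives
   [C * delta <= eta], and [C + 1] is positive even if [C = 0]. *)
exists (eta / (C + 1)) => [|U hU UW]; first exact: divr_gt0.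
have bU := graphon_bounded_measurable hU; have bW := graphon_bounded_measurable hW.
have [im _ _ _] := hm.
pose h := phi \* U; have bh : bounded_measurable h by exact: bounded_measurableM.
have iUW : (P \x P)%E.-integrable setT (EFin \o (U \- W)).
  by apply: bounded_measurable_integrable; exact: bounded_measurableB.
have ihm : (P \x P)%E.-integrable setT (EFin \o (h \- m)).
  by apply: integrable_funB => //; exact: bounded_measurable_integrable.
have ipW : (P \x P)%E.-integrable setT (EFin \o ((phi \* W) \- m)).
  apply: integrable_funB => //; apply: bounded_measurable_integrable.
  exact: bounded_measurableM.
have hm_close : cut_le P (h \- m) (eta + eta).
  (* The first summand is cut-small by the multiplier bound, the second is small in L^1; each
     contributes [eta]. *)
  have -> : h \- m = (phi \* (U \- W)) \+ ((phi \* W) \- m).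
    by apply/funext => z; rewrite /h /=; ring.
  apply: cut_leD => //; [exact: bounded_measurable_integrableM| |exact: cut_le_L1].
  have /(hC _ _ iUW) h1 : cut_le P (U \- W) (eta / (C + 1)).
    by apply/cut_le_norm => //; exact: ltW.
  move=> A B mA mB; apply: le_trans (h1 A B mA mB) _.
  by rewrite mulrCA ler_piMr ?(ltW eta0) // ler_pdivrMr // mul1r lerDl.
have h0 z : 0 <= h z.
  by have [_ _ /(_ z)/andP[U0 _]] := hU; exact: mulr_ge0.
have hU0 z : U z = 0 -> h z = 0 by rewrite /h /= => ->; rewrite mulr0.
have [mU mUU mUh] := matching_of_cut_close hm bh h0 hU0 hm_close.
exists mU => //.
have [imU _ _ _] := mUU.
have imUh : (P \x P)%E.-integrable setT (EFin \o (mU \- h)).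
  by apply: integrable_funB => //; exact: bounded_measurable_integrable.
have E : mU \- m = (mU \- h) \+ (h \- m).
  by apply/funext => z /=; rewrite addrA subrK.
have /cut_le_norm : cut_le P (mU \- m) ((eta + eta) + (eta + eta) + (eta + eta)).
  by rewrite E; exact: cut_leD.
move=> /(_ (integrable_funB imU im)) /le_lt_trans; apply.
by rewrite lte_fin /eta; lra.
Qed.
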